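(* Let $m\ge 4$ and $h\ge 0$, and let $(G,D)$ be a finite $3$-transposition group of type $3^{\bullet h}{:}\operatorname{Sym}(m)$. Then the diagram of $(G,D)$ has size $n=3^{h}m(m-1)/2$ and spectrum $$((\,3^{h}(2m-3)-1;\ [3^h(m-3)-1]^{m-1},\ [-3^{h}-1]^{m(m-3)/2},\ [-1]^{\star}\,)).$$
   Context: A $3$-transposition group $(G,D)$ is a group $G$ generated by a conjugacy class $D$ of elements of order $2$ such that $|de|\in\{1,2,3\}$ for all $d,e\in D$. Its diagram is the graph with vertex set $D$ in which $d$ and $e$ are adjacent iff $|de|=3$; its size is $n=|D|$. The spectrum is that of the $(0,1)$-adjacency matrix, written $((k;\dots,[r]^c,\dots))$: first the degree $k$ of the (regular) diagram, counted once, then the remaining eigenvalues, $[r]^c$ meaning $r$ with multiplicity $c$; if listed values coincide, their multiplicities are added, and $[r]^\star$ means that $r$ has whatever further multiplicity (possibly zero) is required for the total multiplicity to be $n$. $(G,D)$ has type $3^{\bullet h}{:}\operatorname{Sym}(m)$ if $G$ has a normal $3$-subgroup $N$ with $|D\cap dN|=3^h$ for all $d\in D$ and $(G/N,DN/N)$ is isomorphic to $\operatorname{Sym}(m)$ with its class of transpositions. (The diagram depends only on $3^h$ and the quotient; whether the extension splits plays no role.) *)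

(* Defs.v *)
From mathcomp Require Import all_boot all_order all_fingroup all_algebra.
From mathcomp Require Import all_solvable all_field.

Set Implicit Arguments.
Unset Strict Implicit.
Unset Printing Implicit Defensive.

Import GroupScope GRing.Theory.

Definition three_transposition_group (gT : finGroupType)
    (G : {group gT}) (D : {set gT}) : Prop :=
  [/\ D \in classes G,
      <<D>> = G,
      {in D, forall d, #[d] = 2}
    & {in D &, forall d e, #[d * e] \in [:: 1; 2; 3]%N}].

Definition transpositions (m : nat) : {set 'S_m} :=
  [set s : 'S_m | [exists i, exists j, (i != j) && (s == tperm i j)]].

(* (G, D) has type 3^{bullet h}:Sym(m); D / N is the image DN/N of D in G / N. *)
Definition has_type_3h_Sym (gT : finGroupType) (h m : nat)
    (G : {group gT}) (D : {set gT}) : Prop :=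
  exists N : {group gT},
    [/\ N <| G,
        3.-group N,
        {in D, forall d, #|D :&: d *: N| = (3 ^ h)%N}
      & exists f : {morphism G / N >-> 'S_m},
          isom (G / N) [set: 'S_m] f /\ f @* (D / N) = transpositions m].

Definition diagram_adj (gT : finGroupType) : rel gT :=
  fun d e => #[d * e] == 3.

Definition diagram_mx (gT : finGroupType) (D : {set gT}) : 'M[algC]_#|D| :=
  (\matrix_(i, j) (diagram_adj (enum_val i) (enum_val j))%:R)%R.

(* The eigenvalues, as roots of the characteristic polynomial, repeated
   according to multiplicity; only meaningful up to perm_eq. *)
Definition spectrum (n : nat) (A : 'M[algC]_n) : seq algC :=
  sval (closed_field_poly_normal (char_poly A)).

(* The spectrum of the diagram is ((k; s)): the diagram is regular of degree k,
   and s lists the eigenvalues remaining once k has been counted once. *)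
Definition has_diagram_spectrum (gT : finGroupType) (D : {set gT})
    (k : algC) (s : seq algC) : Prop :=
  {in D, forall d, (#|[set e in D | diagram_adj d e]|%:R = k)%R}
  /\ perm_eq (spectrum (diagram_mx D)) (k :: s).

(* The spectrum ((k; s, [r]^star)) of a diagram of size n = #|D|. If s were too
   long the subtraction would truncate to 0, but then perm_eq fails because
   spectrum (diagram_mx D) has size n. *)
Definition has_diagram_spectrum_star (gT : finGroupType) (D : {set gT})
    (k : algC) (s : seq algC) (r : algC) : Prop :=
  has_diagram_spectrum D k (s ++ nseq (#|D| - (size s).+1) r).

(* Main.v *)
Require Import Defs.
From mathcomp Require Import all_boot all_order all_fingroup all_algebra.
From mathcomp Require Import all_solvable all_field.
From mathcomp Require Import zify ring.

(** Let p map d in D to the transposition that is its image in G / N = Sym(m).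
    For d and e in D, if p d * p e has order 2 or 3 then so has d * e, since its
    order is at most 3; if p d = p e then d * e lies in the 3-group N, so d and e
    are equal or adjacent. Hence A + 1 is the blow-up, with all fibres of size
    q = 3^h, of K = B B^T - 1, where B is the incidence matrix between the
    transpositions and the m points. The spectra follow from
    X^p char(UV) = X^n char(VU), applied to the blow-up, to B B^T against
    B^T B = (m - 2) 1 + J, and to J = 1 1^T. *)

Set Implicit Arguments.
Unset Strict Implicit.
Unset Printing Implicit Defensive.

(** * Characteristic polynomials of products, shifts and blow-ups *)

Section CharPoly.
Import GRing.Theory.
Local Open Scope ring_scope.

(* Both sides are X^p times the determinant of [[X, U], [V, 1]]. *)
Lemma char_poly_mulmxC (R : comNzRingType) n p (U : 'M[R]_(n, p))
    (V : 'M[R]_(p, n)) :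
  'X^p * char_poly (U *m V) = 'X^n * char_poly (V *m U).
Proof.
pose U' := map_mx polyC U; pose V' := map_mx polyC V.
pose B := block_mx 'X%:M U' V' 1%:M.
have detB : \det B = char_poly (U *m V).
  have: \det (B *m block_mx 1%:M 0 (- V') 1%:M) = char_poly (U *m V).
    rewrite mulmx_block !mulmx1 !mulmx0 !mul1mx add0r mulmxN addrN add0r.
    by rewrite det_ublock det1 mulr1 /char_poly /char_poly_mx map_mxM.
  by rewrite det_mulmx det_lblock !det1 !mulr1.
have: \det (block_mx 1%:M 0 (- V') 'X%:M *m B) = 'X^n * char_poly (V *m U).
  rewrite mulmx_block !mul1mx !mul0mx !addr0 !mulmx1 !mulNmx.
  rewrite -scalar_mxC addNr det_ublock det_scalar addrC.
  by rewrite /char_poly /char_poly_mx map_mxM.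
by rewrite det_mulmx det_lblock det1 mul1r det_scalar detB.
Qed.

Lemma prod_XsubC_nseq (R : nzRingType) n (c : R) :
  \prod_(x <- nseq n c) ('X - x%:P) = ('X - c%:P) ^+ n.
Proof. by rewrite big_nseq -Monoid.iteropE. Qed.

(** Cancelling $X^p$ in the exchange identity leaves a factor $X^{n-p}$: passing to the larger
    product only adds [n - p] zero eigenvalues. *)
Lemma char_poly_mulmx_nseq (R : idomainType) n p (U : 'M[R]_(n, p))
    (V : 'M[R]_(p, n)) (s : seq R) :
    (p <= n)%N -> char_poly (V *m U) = \prod_(x <- s) ('X - x%:P) ->
  char_poly (U *m V) = \prod_(x <- s ++ nseq (n - p) 0) ('X - x%:P).
Proof.
move=> le_pn defs; have nzX : 'X^p != 0 :> {poly R}.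
  by rewrite expf_neq0 ?polyX_eq0.
apply: (mulfI nzX); rewrite char_poly_mulmxC big_cat /= -defs.
by rewrite prod_XsubC_nseq subr0 mulrCA -exprD subnKC // mulrC.
Qed.

(** Substituting $X - c$ for $X$ in the characteristic matrix of [A] gives that of [A + c%:M], so
    every root moves by [c]. *)
Lemma char_polyD_scalar (R : comNzRingType) n (A : 'M[R]_n) (c : R)
    (s : seq R) :
    char_poly A = \prod_(x <- s) ('X - x%:P) ->
  char_poly (A + c%:M) = \prod_(x <- [seq x + c | x <- s]) ('X - x%:P).
Proof.
move=> defs; have -> : char_poly (A + c%:M) = char_poly A \Po ('X - c%:P).
  rewrite /char_poly -[RHS]det_map_mx; congr (\det _).
  apply/matrixP=> i j; rewrite !mxE rmorphB /= rmorphMn /= comp_polyX.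
  by rewrite comp_polyC polyCD polyCMn mulrnBl opprD addrAC addrA.
rewrite defs rmorph_prod big_map; apply: eq_bigr => x _.
by rewrite /= rmorphB /= comp_polyX comp_polyC polyCD opprD addrAC addrA.
Qed.

Lemma char_poly_scalar1 (R : comNzRingType) (c : R) :
  char_poly (c%:M : 'M_1) = 'X - c%:P.
Proof. by rewrite /char_poly det_mx11 !mxE. Qed.

(* mxsub g g K is C K C^T for the 0-1 matrix C of g, and C^T C = q. *)
Lemma char_poly_mxsub (R : idomainType) n p q (g : 'I_n -> 'I_p)
    (K : 'M[R]_p) (s : seq R) :
    (p <= n)%N -> (forall j, #|[set i | g i == j]| = q) ->
    char_poly (q%:R *: K) = \prod_(x <- s) ('X - x%:P) ->
  char_poly (mxsub g g K) = \prod_(x <- s ++ nseq (n - p) 0) ('X - x%:P).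
Proof.
move=> le_pn fib_g defs; pose C : 'M[R]_(n, p) := rowsub g 1%:M.
have -> : mxsub g g K = C *m (K *m C^T).
  rewrite mulmxA mul_rowsub_mx mul1mx /C trmx_mxsub trmx1 mulmx_colsub mulmx1.
  by apply/matrixP=> i j; rewrite !mxE.
apply: char_poly_mulmx_nseq => //; rewrite -{}defs -mulmxA.
congr char_poly; suff -> : C^T *m C = q%:R%:M by rewrite mul_mx_scalar.
apply/matrixP=> j k; rewrite !mxE -(fib_g j) -sum1dep_card.
transitivity (\sum_i ((g i == j) && (j == k))%:R : R).
  apply: eq_bigr => i _; rewrite !mxE -natrM mulnb.
  by case: eqVneq => // ->.
case: (j == k) => /=; last first.
  by rewrite big1 // => i _; rewrite andbF.
by rewrite natr_sum [RHS]big_mkcond /=; apply: eq_bigr => i _; case: eqP.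
Qed.

End CharPoly.

(** * Incidences between transpositions and the points they move *)

Section Transpositions.
Variable m : nat.
Implicit Types (s t : 'S_m) (i j : 'I_m).
Import GroupScope.

Lemma transpositionP t :
  reflect (exists i j, i != j /\ t = tperm i j) (t \in transpositions m).
Proof.
rewrite inE; apply: (iffP existsP) => [[i /existsP[j /andP[ij /eqP->]]]|].
  by exists i, j.
by case=> i [j [ij ->]]; exists i; apply/existsP; exists j; rewrite ij /=.
Qed.

Lemma tperm_neq i j k : i != j -> (tperm i j k != k) = (k \in [set i; j]).
Proof.
move=> ij; rewrite !inE; case: tpermP => [->|->|/eqP/negPf-> /eqP/negPf->].
- by rewrite eqxx eq_sym ij.
- by rewrite eqxx ij orbT.
- by rewrite eqxx.
Qed.

Lemma card_moved t :
  t \in transpositions m -> #|[set i | t i != i]| = 2.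
Proof.
case/transpositionP=> i [j [ij ->]].
transitivity #|[set i; j]|; last by rewrite cards2 ij.
by apply: eq_card => k; rewrite inE tperm_neq.
Qed.

(** These are the $(i\,j)$ with $j \ne i$; the count is the diagonal entry of $B^T B$. *)
Lemma card_transpositions_moving i :
  #|[set t in transpositions m | t i != i]| = m.-1.
Proof.
have -> : [set t in transpositions m | t i != i] = tperm i @: [set~ i].
  apply/setP=> t; rewrite inE; apply/andP/imsetP.
    case=> /transpositionP[k [l [kl ->]]]; rewrite tperm_neq // !inE.
    case/orP=> /eqP->; [exists l | exists k]; rewrite ?inE ?(tpermC k l) //.
    by rewrite eq_sym.
  case=> j; rewrite in_setC1 eq_sym => ij ->; split; last by rewrite tpermL eq_sym.
  by apply/transpositionP; exists i, j.
rewrite card_imset ?cardsC1 ?card_ord // => j k /(congr1 (fun s => s i)).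
by rewrite !tpermL.
Qed.

Lemma card_transpositions_moving2 i j : i != j ->
  #|[set t in transpositions m | (t i != i) && (t j != j)]| = 1%N.
Proof.
move=> ij; rewrite (_ : [set t in _ | _] = [set tperm i j]) ?cards1 //.
apply/setP=> t; rewrite [RHS]inE inE; apply/andP/eqP => [[] | ->]; last first.
  split; first by apply/transpositionP; exists i, j.
  by rewrite !tperm_neq // !inE !eqxx orbT.
case/transpositionP=> k [l [kl ->]]; rewrite !tperm_neq // !inE.
case/andP=> /orP[]/eqP eq1 /orP[]/eqP eq2; rewrite ?eq1 ?eq2 // in ij *.
- by rewrite eqxx in ij.
- by rewrite tpermC.
- by rewrite eqxx in ij.
Qed.

(** The product is a 3-cycle; it is enough that its square sends [i] to [k]. *)
Lemma order_tpermM_shared i j k :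
  i != j -> i != k -> j != k -> #[tperm i j * tperm i k] != 2.
Proof.
move=> ij ik jk; apply/eqP=> ord2.
have: ((tperm i j * tperm i k) ^+ 2) i = i by rewrite -ord2 expg_order perm1.
rewrite expgS expg1 !permM tpermL (tpermD ij) ?(eq_sym k) // tpermR tpermL.
by move/eqP; rewrite eq_sym (negPf ik).
Qed.

Lemma order_tpermM_disjoint i j k l :
    i != j -> k != l -> k \notin [set i; j] -> l \notin [set i; j] ->
  #[tperm i j * tperm k l] = 2.
Proof.
rewrite !inE !negb_or => ij kl /andP[ki kj] /andP[li lj].
have cst: commute (tperm i j) (tperm k l).
  by apply/commgP/conjg_fixP; rewrite tpermJ !tpermD // eq_sym.
apply/eqP; rewrite eqn_leq dvdn_leq //=; last first.
  by rewrite order_dvdn expgMn // expgS expg1 tperm2 expgS expg1 tperm2 mulg1.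
rewrite order_gt1; apply/eqP=> /(congr1 (fun s : 'S_m => s k)).
rewrite permM perm1 [tperm i j k]tpermD 1?eq_sym // tpermL => /eqP.
by rewrite eq_sym (negPf kl).
Qed.

(** Computes the entries of $B B^T$. Equal, overlapping and disjoint transpositions share 2, 1 and 0
    points, and their products have order 1, 3 and 2. *)
Lemma card_moved_by_both s t :
    s \in transpositions m -> t \in transpositions m ->
  #|[set i | (s i != i) && (t i != i)]| = ((s == t) + (#[s * t] != 2))%N.
Proof.
move=> /transpositionP[i [j [ij ->]]] /transpositionP[k [l [kl ->]]].
have -> : #|[set x | (tperm i j x != x) && (tperm k l x != x)]|
        = ((k \in [set i; j]) + (l \in [set i; j]))%N.
  rewrite -!(tperm_neq _ ij) -sum1dep_card.
  under eq_bigl => x do rewrite andbC (tperm_neq x kl).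
  rewrite big_mkcondr big_setU1 ?inE //= big_set1.
  by case: (tperm i j k != k); case: (tperm i j l != l).
have [kin|kin] := boolP (k \in _); have [lin|lin] := boolP (l \in _).
- suff -> : tperm k l = tperm i j by rewrite eqxx tperm2 order1.
  move: kin lin kl; rewrite !inE => /orP[]/eqP-> /orP[]/eqP->; rewrite ?eqxx //.
  by rewrite tpermC.
- have ne: tperm i j == tperm k l = false.
    apply: contraNF lin => /eqP eqt; rewrite -(tperm_neq _ ij) eqt tpermR.
    exact: kl.
  rewrite {}ne; move: kin lin; rewrite !inE negb_or.
  case/orP=> /eqP ? /andP[li lj]; subst k.
    by rewrite order_tpermM_shared // eq_sym.
  by rewrite (tpermC i) order_tpermM_shared // eq_sym.
- have ne: tperm i j == tperm k l = false.
    apply: contraNF kin => /eqP eqt; rewrite -(tperm_neq _ ij) eqt tpermL.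
    by rewrite eq_sym.
  rewrite {}ne; move: kin lin; rewrite !inE negb_or.
  rewrite (tpermC k); case/andP=> [ki kj] /orP[] /eqP ?; subst l.
    by rewrite order_tpermM_shared // eq_sym.
  by rewrite (tpermC i) order_tpermM_shared // eq_sym.
- rewrite order_tpermM_disjoint // eqxx addn0; case: eqP => // eqt.
  by move: kin; rewrite -(tperm_neq _ ij) eqt tpermL eq_sym kl.
Qed.

(** Double counting: each of the two points moved by [s] is moved by $m-1$ transpositions. *)
Lemma sum_moved_by_both s : s \in transpositions m ->
  \sum_(t in transpositions m) #|[set i | (s i != i) && (t i != i)]|
    = (2 * m.-1)%N.
Proof.
move=> Ts; transitivity (\sum_(i in [set i | s i != i]) m.-1)%N; last first.
  by rewrite sum_nat_const card_moved.
under eq_bigr => t _ do rewrite -sum1dep_card big_mkcondr.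
rewrite exchange_big; apply: eq_big => [i | i _]; first by rewrite inE.
by rewrite -big_mkcondr -(card_transpositions_moving i) -sum1dep_card.
Qed.

Lemma card_transpositions : (#|transpositions m| * 2 = m * m.-1)%N.
Proof.
transitivity (\sum_(t in transpositions m) #|[set i | t i != i]|)%N.
  by rewrite -sum_nat_const; apply: eq_bigr => t /card_moved.
under eq_bigr => t _ do rewrite -sum1dep_card big_mkcond.
transitivity (\sum_(i < m) m.-1)%N; last by rewrite sum_nat_const card_ord.
rewrite exchange_big; apply: eq_bigr => i _; rewrite -big_mkcondr.
by rewrite -(card_transpositions_moving i) -sum1dep_card.
Qed.

End Transpositions.

(** * From the group to the transpositions of Sym(m) *)

Section Projection.
Import GroupScope.

(** Extracts all that the spectrum needs from the group. The last clause says that the entries of $A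
    + 1$ depend only on the images under [p]. *)
Lemma diagram_projection m h (gT : finGroupType) (G : {group gT})
    (D : {set gT}) :
    three_transposition_group G D -> has_type_3h_Sym h m G D ->
  exists p : gT -> 'S_m,
    [/\ {in D, forall d, p d \in transpositions m},
        {in transpositions m, forall t, #|[set d in D | p d == t]| = 3 ^ h}%N
      & {in D &, forall d e,
          diagram_adj d e + (d == e) = (#[p d * p e]%g != 2)}%N].
Proof.
case=> _ genD ordD ordDD [N [nNG pN fibN [f [isof fD]]]].
have [injf _] := isomP isof.
have sDG : D \subset G by rewrite -genD subset_gen.
have sDN : D \subset 'N(N) := subset_trans sDG (normal_norm nNG).
have sGN x : x \in D -> coset N x \in G / N.
  by move/(subsetP sDG); apply: mem_quotient.
pose p d := f (coset N d); exists p.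
have fibE d e : d \in D -> e \in D -> (p e == p d) = (e \in d *: N).
  move=> Dd De; rewrite mem_lcoset; have Nd := subsetP sDN _ Dd.
  have Ne := subsetP sDN _ De.
  rewrite (inj_in_eq (injmP injf)) ?sGN // [LHS]eq_sym eq_mulVg1.
  rewrite -morphV // -morphM ?groupV //; apply/eqP/idP; last exact: coset_id.
  by apply: coset_idr; rewrite groupM ?groupV.
have pT d : d \in D -> p d \in transpositions m.
  move=> Dd; rewrite -fD; apply: mem_morphim (sGN _ Dd) _.
  exact: mem_morphim (subsetP sDN _ Dd) Dd.
split=> // [t | d e Dd De].
  (* Any transposition is [p d] for some [d] in [D], and its fibre is then $D \cap dN$. *)
  rewrite -fD => /morphimP[_ _ /morphimP[d _ Dd ->] ->].
  rewrite -(fibN d Dd); apply: eq_card => e; rewrite !inE.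
  by case De: (e \in D); rewrite //= -fibE.
have Nde : d * e \in 'N(N) by rewrite groupM ?(subsetP sDN).
have -> : #[p d * p e] = #[coset N (d * e)].
  rewrite /p -morphM ?sGN // -morphM ?(subsetP sDN) // (order_injm injf) //.
  by rewrite mem_quotient // groupM ?(subsetP sDG).
have dvd_o : #[coset N (d * e)] %| #[d * e] by apply: morph_order.
(* Elements of [D] are involutions, so [d = e] exactly when [d * e] is trivial. *)
have eE : e^-1 = e by rewrite invg_expg ordD // expg1.
have deE : (d == e) = (#[d * e] == 1%N).
  by rewrite order_eq1 -{2}eE -eq_mulgV1.
rewrite /diagram_adj deE; have := ordDD _ _ Dd De; rewrite !inE.
case/or3P=> /eqP o_de; rewrite o_de in dvd_o *.
- by move: dvd_o; rewrite dvdn1 => /eqP->.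
- move: dvd_o; rewrite dvdn_divisors // !inE => /orP[]/eqP o1; last first.
    by rewrite o1.
  (* A trivial image would put an element of order 2 in the 3-group [N]. *)
  have: d * e \in N by apply: coset_idr => //; apply/eqP; rewrite -order_eq1 o1.
  by move/(mem_p_elt pN); rewrite /p_elt o_de.
- by move: dvd_o; rewrite dvdn_divisors // !inE => /orP[]/eqP->.
Qed.

Lemma sum_fibers (I J : finType) (A : {set I}) (B : {set J}) (p : I -> J) q
    (F : J -> nat) :
    {in A, forall i, p i \in B} ->
    {in B, forall j, #|[set i in A | p i == j]| = q} ->
  (\sum_(i in A) F (p i) = q * \sum_(j in B) F j)%N.
Proof.
move=> pB fib; rewrite (partition_big p (mem B)) //= big_distrr /=.
apply: eq_bigr => j Bj; rewrite -(fib j Bj) -sum1dep_card big_distrl /=.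
by apply: eq_bigr => i /andP[_ /eqP->]; rewrite mul1n.
Qed.

End Projection.

(** * The spectrum of the matrix on transpositions *)

Section Spectrum.
Import GRing.Theory.
Local Open Scope ring_scope.

(* K + 1 is B B^T for the incidence matrix B between transpositions and points,
   and B^T B = (m - 2) 1 + J. *)
Lemma char_poly_triangular (R : idomainType) m (q : R)
    (T := transpositions m)
    (K : 'M[R]_#|T| :=
       \matrix_(a, b) (#[enum_val a * enum_val b]%g != 2%N)%:R) :
    (3 <= m)%N ->
  char_poly (q *: K) =
    \prod_(x <- q * (2 * m%:R - 3) :: nseq (m - 1) (q * (m%:R - 3))
                ++ nseq (#|T| - m) (- q)) ('X - x%:P).
Proof.
move=> le3m.
pose B : 'M[R]_(#|T|, m) := \matrix_(a < #|T|, i < m) (enum_val a i != i)%:R.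
have le_mT : (m <= #|T|)%N.
  have := card_transpositions m; rewrite -/T => cT.
  by rewrite -(leq_pmul2r (isT : 0 < 2)%N) cT leq_mul //; lia.
have BBt : q *: K = B *m (q *: B^T) + (- q)%:M.
  rewrite -scalemxAr -scalemx1 scaleNr -scalerBr; congr (_ *: _).
  apply/matrixP=> a b; rewrite !mxE.
  under eq_bigr => i _ do rewrite !mxE -natrM mulnb.
  rewrite -natr_sum -big_mkcond sum1dep_card.
  rewrite card_moved_by_both ?enum_valP // natrD (inj_eq enum_val_inj).
  by rewrite addrAC subrr add0r.
have BtB : q *: B^T *m B = const_mx 1 *m (const_mx q : 'rV_m)
                           + (q * (m%:R - 2))%:M.
  apply/matrixP=> i j; rewrite -scalemxAl !mxE big_ord1 !mxE mul1r.
  under eq_bigr => a _ do rewrite !mxE -natrM mulnb.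
  rewrite -natr_sum -(big_enum_val (fun t : 'S_m => (t i != i) && (t j != j) : nat)).
  rewrite -big_mkcondr sum1dep_card.
  case: eqVneq => [<-|ij]; last first.
    by rewrite card_transpositions_moving2 // mulr1 addr0.
  under eq_finset => t do rewrite andbb.
  rewrite card_transpositions_moving -subn1 natrB; last by lia.
  by rewrite [_ *+ true]mulr1n; ring.
(* Exchanging the factors of $qJ$ leaves a 1 by 1 matrix with entry $qm$. *)
rewrite BBt; pose s0 := [:: q * m%:R].
have defs0 : char_poly ((const_mx q : 'rV[R]_m) *m (const_mx 1 : 'cV_m)) =
             \prod_(x <- s0) ('X - x%:P).
  rewrite big_seq1 -char_poly_scalar1; congr char_poly.
  apply/matrixP=> i j; rewrite !ord1 !mxE.
  under eq_bigr => k _ do rewrite !mxE mulr1.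
  by rewrite sumr_const card_ord mulr_natr.
(* From $qm$: add $m-1$ zeros, shift by $q(m-2)$, add $|T|-m$ zeros, shift by $-q$. *)
have := char_poly_mulmx_nseq (leq_trans (isT : 1 <= 3)%N le3m) defs0.
move/(char_polyD_scalar (q * (m%:R - 2))); rewrite -BtB.
move/(char_poly_mulmx_nseq le_mT)/(char_polyD_scalar (- q)) ->.
rewrite !map_cat !map_nseq /=; congr (\prod_(x <- _) _).
congr (_ :: nseq _ _ ++ nseq _ _); [ring | ring | exact: add0r].
Qed.

Lemma spectrum_perm n (A : 'M[algC]_n) (s : seq algC) :
  char_poly A = \prod_(x <- s) ('X - x%:P) -> perm_eq (spectrum A) s.
Proof.
rewrite /spectrum; case: closed_field_poly_normal => r /= ->.
by rewrite (monicP (char_poly_monic A)) scale1r => /prod_XsubC_eq.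
Qed.

End Spectrum.

(** * Size, degree and spectrum of the diagram *)

Section Diagram.
Import GRing.Theory.
Variables (m q : nat) (gT : finGroupType) (D : {set gT}) (p : gT -> 'S_m).
Local Notation T := (transpositions m).
Hypotheses (pT : {in D, forall d, p d \in T})
  (fibp : {in T, forall t, #|[set d in D | p d == t]| = q})
  (adjE : {in D &, forall d e,
     diagram_adj d e + (d == e) = (#[p d * p e]%g != 2)}%N).

Lemma card_diagram : #|D| = (q * #|T|)%N.
Proof. rewrite -!sum1_card; exact: (sum_fibers (fun=> 1%N) pT fibp). Qed.

(** Sum over [e] in [D] the number of points moved by both [p d] and [p e]. By [card_moved_by_both]
    and [adjE], adjacency contributes the degree, [d = e] contributes 1, and the fibre of [d]
    contributes [q]. *)
Lemma diagram_degree d : d \in D ->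
  (#|[set e in D | diagram_adj d e]| + 1 + q = q * (2 * m.-1))%N.
Proof.
move=> Dd; rewrite -(sum_moved_by_both (pT Dd)) -(sum_fibers _ pT fibp).
have -> : 1%N = (\sum_(e in D) (d == e))%N.
  rewrite (bigD1 d) //= eqxx big1 // => e /andP[_].
  by rewrite eq_sym => /negPf->.
rewrite -{1}(fibp (pT Dd)) -!sum1dep_card !big_mkcondr -!big_split /=.
apply: eq_bigr => e De; rewrite card_moved_by_both ?pT // -adjE // addnC eq_sym.
by congr (_ + (_ + _))%N; case: ifP.
Qed.

Local Open Scope ring_scope.

Lemma char_poly_diagram : (3 <= m)%N -> (0 < q)%N ->
  char_poly (diagram_mx D) =
    \prod_(x <- q%:R * (2 * m%:R - 3) - 1
                :: nseq (m - 1) (q%:R * (m%:R - 3) - 1)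
                ++ nseq (#|T| - m) (- q%:R - 1)
                ++ nseq (#|D| - #|T|) (- 1)) ('X - x%:P).
Proof.
move=> le3m q_gt0; have cT := card_transpositions m.
have le_TD : (#|T| <= #|D|)%N by rewrite card_diagram leq_pmull.
(* The element [d0] only supplies the default value that [enum_rank_in] requires. *)
have /card_gt0P[d0 Dd0] : (0 < #|D|)%N by nia.
pose g (a : 'I_#|D|) := enum_rank_in (pT Dd0) (p (enum_val a)).
have gE a : enum_val (g a) = p (enum_val a).
  by rewrite enum_rankK_in ?pT ?enum_valP.
have fibg j : #|[set a | g a == j]| = q.
  rewrite -(fibp (enum_valP j)) -!sum1dep_card big_mkcondr [RHS]big_enum_val.
  by rewrite -big_mkcond; apply: eq_bigl => a; rewrite -(inj_eq enum_val_inj) gE.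
(* The blow-up of [K] along [g] is $A + 1$; its nonzero part comes from $qK$, and the final shift by
   $-1$ recovers $A$. *)
have := char_poly_mxsub le_TD fibg (char_poly_triangular (q%:R : algC) le3m).
move/(char_polyD_scalar (- 1)).
rewrite /= !map_cat !map_nseq -catA add0r => <-; congr char_poly.
apply/matrixP=> a b; rewrite !mxE !gE -adjE ?enum_valP //.
by rewrite natrD (inj_eq enum_val_inj) mulNrn addrK.
Qed.

End Diagram.

Theorem proposition6p4 (m h : nat) (gT : finGroupType)
    (G : {group gT}) (D : {set gT})
    (hm : (4 <= m)%N)
    (hGD : three_transposition_group G D)
    (htype : has_type_3h_Sym h m G D) :
  #|D| = (3 ^ h * m * (m - 1) %/ 2)%N
  /\ has_diagram_spectrum_star D
       (3 ^+ h * (2 * m%:R - 3) - 1)%R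
       (nseq (m - 1) (3 ^+ h * (m%:R - 3) - 1)%R
        ++ nseq (m * (m - 3) %/ 2) (- 3 ^+ h - 1)%R)
       (- 1)%R.
Proof.
have [p [pT fibp adjE]] := diagram_projection hGD htype.
have q_gt0 : (0 < 3 ^ h)%N by rewrite expn_gt0.
have cardD := card_diagram pT fibp.
have cT := card_transpositions m.
(* $m(m-1)/2 - m = m(m-3)/2$. *)
have eT : (#|transpositions m| - m = m * (m - 3) %/ 2)%N by nia.
have le_mT : (m <= #|transpositions m|)%N by nia.
split; first by rewrite cardD -mulnA subn1 -cT mulnA mulnK.
split=> [d Dd|].
  have := congr1 (fun n => n%:R : algC)%R (diagram_degree pT fibp adjE Dd).
  rewrite -subn1 /= !GRing.natrD !GRing.natrM GRing.natrB; last by lia.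
  rewrite GRing.natrX => /(canRL (GRing.addrK _))/(canRL (GRing.addrK _)) ->.
  by ring.
apply: spectrum_perm.
rewrite (char_poly_diagram pT fibp adjE (ltnW hm) q_gt0) GRing.natrX -eT -catA.
(* The listed eigenvalues number $1 + (m-1) + (|T|-m) = |T|$, with no truncation by [le_mT], so $-1$
   is repeated $|D|-|T|$ more times. *)
by rewrite size_cat !size_nseq; congr (\prod_(x <- _ :: _ ++ _ ++ nseq _ _) _)%R; lia.
Qed.
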